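(* Let $T$ be an initial, hook-shaped increasing tableau. Then $T$ is a unique rectification target (URT) if and only if both $\mathrm{arm}(T)$ and $\mathrm{leg}(T)$ have consecutive entries.
   Context: An increasing tableau of straight shape (simply ''tableau'') is a filling of the Young diagram of a partition (rows numbered downward) by positive integers, strictly increasing left to right along rows and down columns. It is initial if its set of labels is $[n]=\{1,\dots,n\}$ for some $n$. It is hook-shaped if its shape is $(m,1^n)$ for some $m\ge1$, $n\ge0$. For a hook-shaped tableau $T$, $\mathrm{arm}(T)$ is the ordered tuple of labels of the first row, read left to right, excluding the leftmost box; $\mathrm{leg}(T)$ is the ordered tuple of labels of the first column, read top to bottom, excluding its topmost box. A tuple $(c_1,\dots,c_r)$ has consecutive entries if $c_{i+1}=c_i+1$ for $1\le i<r$ (vacuously true if $r\le1$). $K$-Knuth equivalence. On words in the positive integers, $\equiv$ is the equivalence relation generated by the following replacements of consecutive letters: $xzy\equiv zxy$ $(x<y<z)$; $yxz\equiv yzx$ $(x<y<z)$; $x\equiv xx$; $xyx\equiv yxy$. The row word $\mathrm{row}(T)$ reads the entries of $T$ left to right along each row, from the bottom row to the top row. Tableaux satisfy $T\equiv T'$ if $\mathrm{row}(T)\equiv\mathrm{row}(T')$. A tableau $T$ is a unique rectification target (URT) if it is the only tableau of straight shape in its $K$-Knuth equivalence class, i.e. $T'\equiv T$ implies $T'=T$. *)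

(* Defs.v *)
From Stdlib Require Export Relations.
From mathcomp Require Export all_boot.

Set Implicit Arguments.
Unset Strict Implicit.
Unset Printing Implicit Defensive.

(* A filling is the list of its rows, top row first; rows and columns are
   indexed from 0.  Rows of a tableau are nonempty, so two tableaux are equal
   exactly when the lists are equal.  The empty tableau [::] is allowed. *)
Definition filling := seq (seq nat).

Definition entry (T : filling) (i j : nat) : nat := nth 0 (nth [::] T i) j.

Definition is_partition (s : seq nat) : Prop := sorted geq s /\ 0 \notin s.

Definition labels (T : filling) : seq nat := flatten T.

Record is_tableau (T : filling) : Prop := IsTableau {
  tableau_shape : is_partition (shape T);
  tableau_pos : forall a, a \in labels T -> 0 < a;
  tableau_rows : forall i j,
    j.+1 < size (nth [::] T i) -> entry T i j < entry T i j.+1;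
  tableau_cols : forall i j,
    j < size (nth [::] T i.+1) -> entry T i j < entry T i.+1 j
}.

Definition initial (T : filling) : Prop :=
  exists n, forall a, (a \in labels T) = (1 <= a <= n).

Definition hook_shaped (T : filling) : Prop :=
  exists m n, 1 <= m /\ shape T = m :: nseq n 1.

Definition first_row (T : filling) : seq nat := head [::] T.
Definition first_col (T : filling) : seq nat := [seq head 0 r | r <- T].

Definition arm (T : filling) : seq nat := behead (first_row T).
Definition leg (T : filling) : seq nat := behead (first_col T).

Definition consecutive_entries (c : seq nat) : Prop :=
  forall i, i.+1 < size c -> nth 0 c i.+1 = (nth 0 c i).+1.

(* Letters range over nat rather than over the positive integers: every
   replacement preserves the set of letters, so the equivalence class of a word
   in positive letters only contains such words. *)
Inductive kknuth_rule : seq nat -> seq nat -> Prop :=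
| KKnuth_xzy x y z : x < y -> y < z -> kknuth_rule [:: x; z; y] [:: z; x; y]
| KKnuth_yxz x y z : x < y -> y < z -> kknuth_rule [:: y; x; z] [:: y; z; x]
| KKnuth_xx x : kknuth_rule [:: x] [:: x; x]
| KKnuth_xyx x y : kknuth_rule [:: x; y; x] [:: y; x; y].

Inductive kknuth_step : seq nat -> seq nat -> Prop :=
| KKnuthStep u v a b :
    kknuth_rule a b -> kknuth_step (u ++ a ++ v) (u ++ b ++ v).

Definition kknuth_equiv : seq nat -> seq nat -> Prop :=
  clos_refl_sym_trans (seq nat) kknuth_step.

Definition row_word (T : filling) : seq nat := flatten (rev T).

Definition tableau_equiv (T T' : filling) : Prop :=
  kknuth_equiv (row_word T) (row_word T').

Definition URT (T : filling) : Prop :=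
  is_tableau T /\
  forall T', is_tableau T' -> tableau_equiv T' T -> T' = T.

(* Main.v *)
(* The greedy computation of longest increasing subwords is a K-Knuth invariant;
   applied to the row word and to its reverse it shows that equivalent tableaux
   have the same first row and the same first column.  So a tableau T' <> T
   equivalent to a hook T is T with extra boxes, among them one at position
   (1,1), with label x say.

   If arm and leg are consecutive, the row word of T or its reverse is
   k ... 2 1 l (l+1) ... m with l <= k+1, and the corresponding word of T' contains
   k ... 1 x l ... m as a subword, up to commuting x and 1, where l < x.  The
   Hecke product of the latter word is strictly larger.  This is detected by
   letting words act on two particles on the integers, the letter i moving a
   particle from i to i+1 when i+1 is free: K-Knuth moves respect this action, and
   it is monotone under taking subwords.

   If the arm has a gap a, b, then y = a+1 is in the leg, and the presence of y
   makes the row words of T and of T with b added at (1,1) equivalent.  A gap in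
   the leg is treated by reversing words. *)

Require Import Defs.
From Stdlib Require Import Setoid Morphisms.
From mathcomp Require Import all_boot zify.

Set Implicit Arguments.
Unset Strict Implicit.
Unset Printing Implicit Defensive.

(* K-Knuth equivalence as a congruence on words *)
Local Infix "=K" := kknuth_equiv (at level 70).

#[local] Instance kknuth_equiv_Equivalence : Equivalence kknuth_equiv.
Proof.
split; first exact: rst_refl.
- exact: rst_sym.
- exact: rst_trans.
Qed.

Lemma kknuth_refl w : w =K w.
Proof. exact: rst_refl. Qed.
#[local] Hint Resolve kknuth_refl : core.

Lemma kknuth_equiv_ind (R : seq nat -> seq nat -> Prop) :
  Equivalence R ->
  (forall u v a b, kknuth_rule a b -> R (u ++ a ++ v) (u ++ b ++ v)) ->
  forall w w', w =K w' -> R w w'.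
Proof.
move=> [Rr Rs Rt] Rrule w w'; elim=> [_ _ [u v a b /Rrule]|x|x y _ /Rs|x y z _ + _] //.
exact: Rt.
Qed.

Lemma kknuth_ctx u v w w' : w =K w' -> u ++ w ++ v =K u ++ w' ++ v.
Proof.
apply: (kknuth_equiv_ind (R := fun w w' => u ++ w ++ v =K u ++ w' ++ v)).
  split=> [x|x y|x y z]; [by []|by symmetry|exact: rst_trans].
move=> u' v' a b ab; rewrite -!catA !(catA u).
by apply: rst_step; constructor.
Qed.

#[local] Instance cat_kknuth :
  Proper (kknuth_equiv ==> kknuth_equiv ==> kknuth_equiv) cat.
Proof.
move=> a b ab c d cd; transitivity (b ++ c).
  exact: (kknuth_ctx [::] c ab).
by have := kknuth_ctx b [::] cd; rewrite !cats0.
Qed.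

#[local] Instance cons_kknuth a :
  Proper (kknuth_equiv ==> kknuth_equiv) (cons a).
Proof. move=> w w' ww'; exact: (cat_kknuth (reflexivity [:: a]) ww'). Qed.

Lemma kknuth_rule_cat a b t : kknuth_rule a b -> a ++ t =K b ++ t.
Proof. by move=> ab; apply: rst_step; exact: (KKnuthStep [::] t ab). Qed.

Lemma kxzy x y z t : x < y -> y < z ->
  [:: x, z, y & t] =K [:: z, x, y & t].
Proof. by move=> xy yz; exact: (kknuth_rule_cat t (KKnuth_xzy xy yz)). Qed.

Lemma kyxz x y z t : x < y -> y < z ->
  [:: y, x, z & t] =K [:: y, z, x & t].
Proof. by move=> xy yz; exact: (kknuth_rule_cat t (KKnuth_yxz xy yz)). Qed.

Lemma kxx x t : x :: t =K [:: x, x & t].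
Proof. exact: (kknuth_rule_cat t (KKnuth_xx x)). Qed.

Lemma kxyx x y t : [:: x, y, x & t] =K [:: y, x, y & t].
Proof. exact: (kknuth_rule_cat t (KKnuth_xyx x y)). Qed.

(** Reversal exchanges the first two rules and preserves the other two; it carries statements about
    arms over to legs. *)
Lemma kknuth_rev w w' : w =K w' -> rev w =K rev w'.
Proof.
apply: (kknuth_equiv_ind (R := fun w w' => rev w =K rev w')).
  split=> [x|x y|x y z]; [by []|by symmetry|exact: rst_trans].
move=> u v a b ab; rewrite !rev_cat -!catA; apply: kknuth_ctx.
case: ab => [x y z xy yz|x y z xy yz|x|x y]; rewrite /rev /=.
- by rewrite (kyxz _ xy yz).
- by rewrite (kxzy _ xy yz).
- exact: kxx.
- exact: kxyx.
Qed.

(** * Absorbing a letter into a hook word with a gap *)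

Lemma path_ltn_last c s : path ltn c s -> c <= last c s.
Proof.
case: s => // e s /(order_path_min ltn_trans)/allP lt_c.
by apply/ltnW/lt_c; exact: mem_last.
Qed.

(** [c] passes the letters of [E] from the smallest up by moves from [z x y] to [x z y]; the role of
    [y] is played by the letter just passed, at first by [d]. *)
Lemma slide_left c d E t : c < d -> path ltn d E ->
  rev E ++ [:: c, d & t] =K c :: rev E ++ d :: t.
Proof.
elim: E d t => [|e E IH] d t cd; first by [].
move=> /= /andP[de pE]; rewrite rev_cons !cat_rcons.
rewrite -(kxzy t cd de); apply: IH => //; exact: ltn_trans de.
Qed.

Lemma slide_right y c A t : path ltn c A -> last c A < y ->
  [:: y, c & A] ++ t =K belast c A ++ [:: y, last c A & t].
Proof.
elim: A c => [|a A IH] c; first by [].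
move=> /= /andP[ca pA] lasty.
have ay : a < y by apply: leq_ltn_trans lasty; exact: path_ltn_last.
by rewrite -(kxzy _ ca ay); apply: cons_kknuth; exact: IH.
Qed.

Lemma slide_corner d c A t : c < d -> path ltn d A ->
  [:: d, c & A] ++ t =K d :: A ++ c :: t.
Proof.
elim: A d => [|a A IH] d cd; first by [].
move=> /= /andP[da pA]; rewrite (kyxz _ cd da); apply: cons_kknuth.
exact: (IH a (ltn_trans cd da)).
Qed.

(** This is Hecke insertion of [last c A] into the row [c A b]: the row is unchanged and [b] is
    bumped out. The braid rule creates the second [b], which then slides left. *)
Lemma bump_out c A b t : path ltn c A -> last c A < b ->
  c :: A ++ [:: b, last c A & t] =K [:: b, c & A] ++ b :: t.
Proof.
elim: A c => [|a A IH] c /=; first by move=> _ _; exact: kxyx.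
move=> /andP[ca pA] lastb; rewrite (IH a pA lastb) /= (kxzy _ ca) //.
by apply: leq_ltn_trans lastb; exact: path_ltn_last.
Qed.

Lemma absorb_cons c y b t : c < y -> y < b ->
  [:: y, c, b, c & t] =K [:: y, c, b & t].
Proof. by move=> cy yb; rewrite (kyxz _ cy yb) -kxx -(kyxz _ cy yb). Qed.

Lemma absorb_tight c y a b t : c < a -> a < y -> y < b ->
  [:: y, a, c, a, b, a & t] =K [:: y, a, c, a, b & t].
Proof.
move=> ca ay yb; have ab := ltn_trans ay yb; have cy := ltn_trans ca ay.
have cb := ltn_trans cy yb.
transitivity [:: y, c, y, b, a, c & t].
  rewrite (kxyx a c) -(kxzy _ ca ay) (kyxz _ ca ab) (kyxz _ ay yb).
  rewrite (kxyx a c).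
  by rewrite -(kyxz _ cy yb) (kxyx c y).
rewrite (kxyx a c) (kyxz _ ca ab) -(kyxz _ ay yb) (kxzy _ ca ay).
by rewrite -kxx.
Qed.

(* Induction on the size of the hook with corner [c], arm [A] and leg [E]
   according to the smallest letter [d] of the leg and [a] of the arm.  If [a < d],
   the corner slides out to the left, leaving a hook with corner [a]; if [a = d],
   rewriting [d c d] into [c d c] lets a copy of [c] slide out, leaving a shorter
   arm; if [d < a], the corner slides out to the right, leaving a hook with corner
   [d] and leg [E'], and is slid back once [b] has been created. *)
Lemma absorb c E A y b :
  path ltn c E -> path ltn c A -> all (geq (last c A)) E ->
  last c A < y -> y < b ->
  y :: rev E ++ c :: A ++ [:: b; last c A] =K y :: rev E ++ c :: A ++ [:: b].
Proof.
have [n] := ubnP (size E + size A); elim: n c E A => // n IH c E A.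
rewrite ltnS => len pE pA allE lasty yb.
case: E len pE allE => [|d E] len pE allE.
  have hop t : y :: c :: A ++ t =K _ := slide_right t pA lasty.
  by rewrite cat0s !hop (absorb_cons _ lasty yb).
case: A pA lasty allE len => [|a A] pA lasty allE len.
  by move: allE pE => /=; lia.
have [cd pdE] : c < d /\ path ltn d E by apply/andP.
have [ca paA] : c < a /\ path ltn a A by apply/andP.
have [dlast allE'] : d <= last a A /\ all (geq (last a A)) E by apply/andP.
have lastE : last d E < y.
  apply: leq_ltn_trans lasty; apply: (allP allE); exact: mem_last.
have pdEy : path ltn d (rcons E y) by rewrite rcons_path pdE.
case: (ltngtP d a) => [da|ad|eda].
- have pdA : path ltn d (a :: A) by rewrite /= da.
  have lastb : last d (a :: A) < b by exact: ltn_trans yb.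
  (* By [bump_out] at the corner [d], the letter absorbed in the induction hypothesis turns into a
     [b] in front of that corner. *)
  have S t : y :: rev E ++ d :: a :: A ++ b :: t =K
             y :: rev E ++ b :: d :: a :: A ++ b :: t.
    have IHd := IH d E (a :: A) len pdE pdA allE' lasty yb.
    have := cat_kknuth IHd (kknuth_refl t).
    by rewrite (bump_out [::] pdA lastb) /= -!catA /= -?catA => ->.
  have pdAb : path ltn d (a :: A ++ [:: b]).
    by rewrite /= da cat_path paA /= andbT.
  have hopc t : [:: d, c, a & A ++ b :: t] =K [:: d, a & A ++ [:: b, c & t]].
    by have := slide_corner t cd pdAb; rewrite /= -!catA.
  (* The letter in front, [y] or the smallest letter of [E], lies strictly between [d] and [b] and
     so lets them commute. *)
  have hopb t : y :: rev E ++ [:: b, d, c & t] =K y :: rev E ++ [:: d, b, c & t].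
    case: E pdE allE' {len pE allE lastE pdEy S} => [|e E] /=.
      by rewrite (kyxz _ (leq_ltn_trans dlast lasty) yb).
    move=> /andP[de _] /andP[ea _]; rewrite rev_cons !cat_rcons.
    by rewrite (kyxz _ de (leq_ltn_trans ea lastb)).
  rewrite (bump_out [::] pA lastb) rev_cons !cat_rcons /=.
  by rewrite hopc S -hopc hopb.
- have hop t : y :: rev (d :: E) ++ [:: c, a & t] =K c :: y :: rev (d :: E) ++ a :: t.
    rewrite -!(cat_cons y) -rev_rcons; apply: slide_left => //.
    by rewrite /= ad.
  rewrite !cat_cons !hop; apply: cons_kknuth; apply: IH => //.
    by move: len; rewrite /= addnS.
  by rewrite /= ad.
- subst d; case: A => [|a' A] in pA paA lasty allE len dlast allE' lastE *.
    have -> : E = [::] by case: E pdE allE' {pE allE len lastE pdEy} => //= e E; lia.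
    exact: absorb_tight.
  have hop t : y :: rev (a :: E) ++ [:: c, a & t] =K c :: y :: rev (a :: E) ++ c :: t.
    rewrite rev_cons !cat_rcons (kxyx a c).
    by rewrite -!(cat_cons y) -rev_rcons; exact: slide_left.
  rewrite !cat_cons !hop; apply: cons_kknuth; apply: (IH c (a :: E) (a' :: A)) => //.
    by move: len; rewrite /= addnS.
  by case/andP: paA => aa' pA'; rewrite /= (ltn_trans ca aa').
Qed.

(** A further copy of [last c A] after [b] can either be absorbed or bump out [b]; the two sides are
    the two outcomes. *)
Lemma add_gap u v c E A y b :
  path ltn c E -> path ltn c A -> all (geq (last c A)) E ->
  last c A < y -> y < b ->
  u ++ y :: rev E ++ c :: A ++ b :: v =K
  u ++ y :: rev E ++ [:: b, c & A] ++ b :: v.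
Proof.
move=> pE pA allE lasty yb.
have := absorb pE pA allE lasty yb.
rewrite (bump_out [::] pA (ltn_trans lasty yb)) => /(kknuth_ctx u v).
by rewrite /= -!catA /= -!catA /= -?catA => ->.
Qed.

Lemma arm_gap c A L i :
  path ltn c A -> path ltn c L -> i.+1 < size A ->
  (nth 0 A i).+1 < nth 0 A i.+1 -> (nth 0 A i).+1 \in L ->
  rev L ++ c :: A =K rev L ++ [:: nth 0 A i.+1, c & A].
Proof.
move=> pA pL ltiA; set a := nth 0 A i; set b := nth 0 A i.+1 => ltab.
have defA : A = take i.+1 A ++ b :: drop i.+2 A.
  by rewrite -[LHS](cat_take_drop i.+1) (drop_nth 0).
have lastA : last c (take i.+1 A) = a.
  by rewrite (take_nth 0) ?last_rcons // ltnW.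
move: pL; rewrite (path_sortedE ltn_trans) => /andP[/allP cL sL] aL.
(* The leg letters [E] before [a.+1] are at most [a], as [absorb] demands; [L2] and the arm beyond
   [b] are only context. *)
case/splitPr: aL sL cL => E L2.
rewrite (sorted_pairwise ltn_trans) pairwise_cat.
move=> /and3P[/allrelP EL pwE _] cL.
have pE : path ltn c E.
  rewrite (path_sortedE ltn_trans) (sorted_pairwise ltn_trans) pwE andbT.
  by apply/allP => x xE; apply: cL; rewrite mem_cat xE.
rewrite rev_cat rev_cons cat_rcons -!catA [in X in X =K _]defA [in X in _ =K X]defA.
apply: add_gap; rewrite ?lastA //; first exact: take_path.
by apply/allP => x xE; have := EL x a.+1 xE; rewrite mem_head ltnS; apply.
Qed.

(** * Tableaux as lists of rows *)

(** Joins the shape and column conditions on two adjacent rows, so that [sorted above] expresses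
    both for a whole filling. *)
Fixpoint above (r s : seq nat) {struct s} : bool :=
  match s, r with
  | [::], _ => true
  | b :: s', a :: r' => (a < b) && above r' s'
  | _ :: _, [::] => false
  end.

Lemma aboveP r s :
  reflect (size s <= size r /\ forall j, j < size s -> nth 0 r j < nth 0 s j)
          (above r s).
Proof.
elim: s r => [|b s IH] [|a r] /=; try by constructor; [].
- by constructor => -[].
- apply: (iffP andP) => [[ab /IH[szs lt_rs]]|[szs lt_rs]].
    by split=> // -[|j] //=; exact: lt_rs.
  by split; [exact: (lt_rs 0)|apply/IH; split=> // j; exact: (lt_rs j.+1)].
Qed.

Lemma nth_shape (T : filling) i : nth 0 (shape T) i = size (nth [::] T i).
Proof.
case: (ltnP i (size T)) => iT; first exact: nth_map.
by rewrite !nth_default ?size_map.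
Qed.

Lemma is_tableauP T :
  is_tableau T <-> [/\ all (sorted ltn) T, sorted above T, [::] \notin T &
                       forall a, a \in labels T -> 0 < a].
Proof.
split=> [[[sh sh0] pos rows cols]|[rows cols nil0 pos]].
- split=> //.
  + by apply/(all_nthP [::]) => i _; apply/(sortedP 0) => j; exact: rows.
  + apply/(sortedP [::]) => i iT; apply/aboveP; split=> [|j]; last exact: cols.
    by have := sortedP 0 sh i; rewrite size_map !nth_shape; apply.
  + by apply: contra sh0 => nilT; apply/mapP; exists [::].
- have rowsT i : sorted ltn (nth [::] T i).
    case: (ltnP i (size T)) => iT; last by rewrite nth_default.
    exact: all_nthP.
  have colsT i j : j < size (nth [::] T i.+1) ->
      size (nth [::] T i.+1) <= size (nth [::] T i) /\
      entry T i j < entry T i.+1 j.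
    case: (ltnP i.+1 (size T)) => iT; last by rewrite nth_default.
    by move/(sortedP [::]): cols => /(_ i iT)/aboveP[le lt] /lt.
  split=> // [|i j|i j /colsT[]] //; last by move/(sortedP 0): (rowsT i); apply.
  split; last by apply: contra nil0 => /mapP[r rT /esym/size0nil <-].
  apply/(sortedP 0) => i; rewrite size_map !nth_shape /= => iT.
  by move/(sortedP [::]): cols => /(_ i iT)/aboveP[].
Qed.

Definition hook c A L : filling := (c :: A) :: [seq [:: x] | x <- L].

Lemma hook_shapedP T :
  hook_shaped T -> exists c, T = hook c (arm T) (leg T).
Proof.
case=> m [n [m0]]; case: T => [|[|c A] T] //= [em sh]; first by rewrite -em in m0.
exists c; rewrite /hook /arm /leg /=; congr (_ :: _).
elim: T n sh {em} => [|[|x [|? ?]] T IH] [|n] //= [] // /IH.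
by move=> {1}->.
Qed.

Lemma row_word_hook c A L : row_word (hook c A L) = rev L ++ c :: A.
Proof. by rewrite /row_word rev_cons flatten_rcons -map_rev flatten_seq1. Qed.

Lemma mem_labels_hook c A L a :
  (a \in labels (hook c A L)) = (a \in c :: A ++ L).
Proof. by rewrite /labels /hook /= flatten_seq1. Qed.

(** * The first row and the first column are invariants *)

(* [g k] is the length of a longest strictly increasing subword with letters
   below [k]; [lis_push g a] updates it when the letter [a] is appended. *)
Definition lis_push (g : nat -> nat) a k := if a < k then maxn (g k) (g a).+1 else g k.

Definition nondecreasing (g : nat -> nat) := {homo g : j k / j <= k}.

Lemma lis_push_nondecreasing g a : nondecreasing g -> nondecreasing (lis_push g a).
Proof.
move=> mg j k jk; rewrite /lis_push; have := mg _ _ jk.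
by case: ifP; case: ifP; lia.
Qed.

Lemma foldl_lis_push_nondecreasing g w :
  nondecreasing g -> nondecreasing (foldl lis_push g w).
Proof. by elim: w g => //= a w IH g mg; apply/IH/lis_push_nondecreasing. Qed.

Lemma foldl_lis_push_eq g g' w : g =1 g' -> foldl lis_push g w =1 foldl lis_push g' w.
Proof.
by elim: w g g' => //= a w IH g g' gg'; apply: IH => k; rewrite /lis_push !gg'.
Qed.

(** The two sides of a rule yield the same maxima because the table left by the prefix is
    nondecreasing, a property that pushing preserves. *)
Lemma foldl_lis_push_kknuth g w w' : nondecreasing g -> w =K w' ->
  foldl lis_push g w =1 foldl lis_push g w'.
Proof.
move=> mg ww'; move: w w' ww' g mg.
apply: (kknuth_equiv_ind (R := fun w w' => forall g, nondecreasing g ->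
  foldl lis_push g w =1 foldl lis_push g w')).
  split=> [//|w w' ww' g mg k|w w' w'' ww' ww'' g mg k]; first by rewrite ww'.
  by rewrite ww' ?ww''.
move=> u v a b ab g mg; rewrite !foldl_cat; apply: foldl_lis_push_eq.
move: (foldl_lis_push_nondecreasing u mg) => {mg}; set h := foldl _ _ _ => mh k.
case: ab => [x y z xy yz|x y z xy yz|x|x y]; rewrite /= /lis_push ?ltnn.
- have := mh x y; have := mh y z; have := mh x z.
  have := mh k x; have := mh k y; have := mh k z.
  have := mh x k; have := mh y k; have := mh z k.
  repeat case: ifP => ?; lia.
- have := mh x y; have := mh y z; have := mh x z.
  have := mh k x; have := mh k y; have := mh k z.
  have := mh x k; have := mh y k; have := mh z k.
  repeat case: ifP => ?; lia.
- repeat case: ifP => ?; lia.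
- have := mh x y; have := mh y x.
  have := mh k x; have := mh k y.
  have := mh x k; have := mh y k.
  repeat case: ifP => ?; lia.
Qed.

(** For strictly increasing [s] this is the table of longest increasing subwords of [s]; [ltcount
    [::]] is the initial zero table. *)
Definition ltcount (s : seq nat) k := count (ltn^~ k) s.

Lemma ltcount_nondecreasing s : nondecreasing (ltcount s).
Proof. by move=> j k jk; apply: sub_count => a /= /leq_trans; apply. Qed.

(** A letter [a] occurs exactly when the count grows from [a] to [a.+1]. *)
Lemma ltcount_inj s t :
  sorted ltn s -> sorted ltn t -> ltcount s =1 ltcount t -> s = t.
Proof.
move=> ss st eq_st; apply: (irr_sorted_eq ltn_trans ltnn) => // a.
have mem_count u : (a \in u) = (ltcount u a < ltcount u a.+1).
  rewrite -has_pred1 has_count.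
  have -> : ltcount u a.+1 = ltcount u a + count_mem a u.
    rewrite /ltcount -count_predUI (@eq_count _ (predI _ _) pred0) ?count_pred0.
      rewrite addn0; apply: eq_count => b /=; lia.
    by move=> b /=; lia.
  by rewrite -ltn_subLR ?subnn.
by rewrite !mem_count !eq_st.
Qed.

Lemma ltcount_ge a s k : all (leq a) s -> k <= a -> ltcount s k = 0.
Proof.
move=> sa ka; apply/eqP; rewrite -leqn0 leqNgt -has_count -all_predC.
by apply: sub_all sa => b /=; lia.
Qed.

Lemma ltcount_lt a s k : all (gtn a) s -> a <= k -> ltcount s k = size s.
Proof.
by move=> sa ak; apply/eqP; rewrite -all_count; apply: sub_all sa => b /=; lia.
Qed.

(** As in patience sorting, [a] replaces the least letter that is at least [a], or is appended if
    there is none. *)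
Lemma lis_push_ltcount u s a : all (gtn a) u -> all (leq a) s -> sorted ltn s ->
  lis_push (ltcount (u ++ s)) a =1 ltcount (rcons u a ++ behead s).
Proof.
move=> ua sa ss k; rewrite /lis_push cat_rcons /ltcount !count_cat -!/(ltcount _ _) /=.
rewrite (ltcount_lt ua (leqnn a)) (ltcount_ge sa (leqnn a)) addn0.
case: ltnP => ak; last first.
  rewrite (ltcount_ge sa ak) (@ltcount_ge a (behead s)) //.
  by case: (s) sa => //= b t /andP[].
rewrite (ltcount_lt ua (ltnW ak)).
case: s sa ss => [|b s] sa ss /=; first by rewrite maxnE; lia.
rewrite /ltcount /= -/(ltcount _ _); case: (ltnP b k) => bk; first by lia.
rewrite (@ltcount_ge b s k) //; first by lia.
by apply: sub_all (order_path_min ltn_trans ss) => e /=; exact: ltnW.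
Qed.

(** With [s] the row below [r], strict columns make each letter of [r] replace the letter under it;
    [u] is the part already read. *)
Lemma lis_push_row u r s :
  sorted ltn (u ++ r) -> sorted ltn s -> above r s ->
  foldl lis_push (ltcount (u ++ s)) r =1 ltcount (u ++ r).
Proof.
elim: r u s => [|a r IH] u s; first by case: s => [|b s].
rewrite (sorted_pairwise ltn_trans) -cat_rcons => pw ss rs k /=.
have ua : all (gtn a) u.
  move: pw; rewrite pairwise_cat pairwise_rcons => /and3P[_ /andP[ua _] _].
  exact: ua.
have sa : all (leq a) s.
  case: s rs ss => //= b s /andP[ab _] /(order_path_min ltn_trans) bs.
  by rewrite (ltnW ab); apply: sub_all bs => e /=; lia.
rewrite (foldl_lis_push_eq r (lis_push_ltcount ua sa ss)) IH //.
- by rewrite (sorted_pairwise ltn_trans).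
- by case: (s) ss => //= b t /path_sorted.
- by case: (s) rs => [|b t] //= /andP[].
Qed.

Lemma foldl_lis_push_row_word T :
  all (sorted ltn) T -> sorted above T ->
  foldl lis_push (ltcount [::]) (row_word T) =1 ltcount (first_row T).
Proof.
rewrite /row_word /first_row; elim: T => [|r T IH] //= /andP[sr sT] aT k.
rewrite rev_cons flatten_rcons foldl_cat.
rewrite (foldl_lis_push_eq r (IH sT (path_sorted aT))).
apply: (lis_push_row (u := [::])) => //.
- by case: (T) sT => //= s ? /andP[].
- by case: (T) aT => [|s ?] /=; [case: (r)|case/andP].
Qed.

(** A reversed row decreases, so each letter replaces the preceding one and only the head [c]
    survives. *)
Lemma lis_push_rev_row u c r : all (gtn c) u -> path ltn c r ->
  foldl lis_push (ltcount u) (rev (c :: r)) =1 ltcount (rcons u c).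
Proof.
elim: r c => [|d r IH] c uc /=.
  move=> _ k; have /= := lis_push_ltcount (s := [::]) uc isT isT k.
  by rewrite !cats0.
case/andP=> cd pr k; rewrite rev_cons foldl_rcons.
have ud : all (gtn d) u by apply: sub_all uc => b /=; lia.
have -> : lis_push (foldl lis_push (ltcount u) (rev (d :: r))) c k = lis_push (ltcount (u ++ [:: d])) c k.
  by rewrite /lis_push !IH ?cats1.
by rewrite lis_push_ltcount //= ?cats0 // andbT ltnW.
Qed.

Lemma rev_row_word T : rev (row_word T) = flatten (map rev T).
Proof. by rewrite /row_word rev_flatten map_rev revK. Qed.

Lemma foldl_lis_push_cols u T :
  (T != [::] -> all (gtn (head 0 (first_row T))) u) ->
  all (sorted ltn) T -> sorted above T -> [::] \notin T ->
  foldl lis_push (ltcount u) (flatten (map rev T)) =1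
  ltcount (u ++ first_col T).
Proof.
elim: T u => [|r T IH] u /= ur; first by rewrite cats0.
case/andP=> sr sT aT; rewrite inE negb_or => /andP[r0 T0] k.
case: r sr r0 aT ur => // c r sr _ aT /(_ isT) uc.
rewrite foldl_cat (foldl_lis_push_eq _ (lis_push_rev_row uc sr)) -cat_rcons.
apply: IH => //; last exact: path_sorted aT.
case: T {sT} aT T0 => [|[|d s] T] //= /andP[/andP[cd _] _] _ _.
rewrite all_rcons /= cd; apply: sub_all uc => b /=; lia.
Qed.

Lemma foldl_lis_push_rev_row_word T :
  all (sorted ltn) T -> sorted above T -> [::] \notin T ->
  foldl lis_push (ltcount [::]) (rev (row_word T)) =1 ltcount (first_col T).
Proof. by rewrite rev_row_word; exact: foldl_lis_push_cols. Qed.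

Lemma first_col_sorted T :
  sorted above T -> [::] \notin T -> sorted ltn (first_col T).
Proof.
case: T => //= r T; rewrite inE negb_or => aT /andP[_].
rewrite /first_col path_map; elim: T r aT => //= s T IH r /andP[rs aT].
rewrite inE negb_or => /andP[s0 T0]; rewrite {}IH // andbT.
by case: r s rs s0 {aT} => [|a r] [|b s] //= /andP[].
Qed.

Lemma equiv_first_row_col T T' : is_tableau T -> is_tableau T' ->
  tableau_equiv T' T -> first_row T' = first_row T /\ first_col T' = first_col T.
Proof.
move=> /is_tableauP[rT aT nT _] /is_tableauP[rT' aT' nT' _] TT'.
have nd0 := @ltcount_nondecreasing [::].
have row_sorted U : all (sorted ltn) U -> sorted ltn (first_row U).
  by case: U => //= r U /andP[].
split; apply: ltcount_inj; rewrite ?row_sorted ?first_col_sorted // => k.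
  rewrite -foldl_lis_push_row_word // (foldl_lis_push_kknuth nd0 TT').
  exact: foldl_lis_push_row_word.
rewrite -foldl_lis_push_rev_row_word //.
rewrite (foldl_lis_push_kknuth nd0 (kknuth_rev TT')).
exact: foldl_lis_push_rev_row_word.
Qed.

(** * A two-particle action of the 0-Hecke monoid *)

(* Particles at [s.1 < s.2]. *)
Definition jump (s : nat * nat) i :=
  let: (p, q) := s in
  if q == i then (p, q.+1) else if (p == i) && (q != i.+1) then (p.+1, q) else s.

Definition pair_le (s t : nat * nat) := (s.1 <= t.1) && (s.2 <= t.2).

Lemma jump_lt s i : s.1 < s.2 -> (jump s i).1 < (jump s i).2.
Proof. by case: s => p q /=; case: eqP => [|_]; [|case: ifP] => /=; lia. Qed.

Lemma foldl_jump_lt s w : s.1 < s.2 -> (foldl jump s w).1 < (foldl jump s w).2.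
Proof. by elim: w s => //= i w IH s /jump_lt-/(_ i); exact: IH. Qed.

Lemma jump_le s t i : s.1 < s.2 -> t.1 < t.2 -> pair_le s t ->
  pair_le (jump s i) (jump t i).
Proof.
case: s t => p q [p' q']; rewrite /pair_le /jump /=.
by repeat case: ifP => ? /=; lia.
Qed.

Lemma jump_ge s i : pair_le s (jump s i).
Proof.
by case: s => p q; rewrite /pair_le /jump /=; repeat case: ifP => ? /=; lia.
Qed.

(** A common letter preserves the componentwise order, and an extra letter of [w'] only pushes
    particles forward. *)
Lemma foldl_jump_subseq s t w w' : s.1 < s.2 -> t.1 < t.2 -> pair_le s t ->
  subseq w w' -> pair_le (foldl jump s w) (foldl jump t w').
Proof.
elim: w' w s t => [|j w' IH] [|i w] s t //= ls lt st.
  move=> _; apply: (IH [::]) => //; first exact: jump_lt.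
    by move: st (jump_ge t j); rewrite /pair_le; lia.
  exact: sub0seq.
case: eqP => [->|_] sub; first by apply: IH => //; [exact: jump_lt..|exact: jump_le].
apply: (IH (i :: w)) => //; first exact: jump_lt.
by move: st (jump_ge t j); rewrite /pair_le; lia.
Qed.

Lemma jumpC s i j : s.1 < s.2 -> i.+1 < j -> jump (jump s i) j = jump (jump s j) i.
Proof.
case: s => p q /= pq ij; rewrite /jump.
by repeat (case: ifP => /= ?); try congr (_, _); lia.
Qed.

Lemma jump_braid s i : s.1 < s.2 ->
  jump (jump (jump s i) i.+1) i = jump (jump (jump s i.+1) i) i.+1.
Proof.
case: s => p q /= pq; rewrite /jump.
by repeat (case: ifP => /= ?); try congr (_, _); lia.
Qed.

Lemma jump_idem s i : s.1 < s.2 -> jump (jump s i) i = jump s i.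
Proof.
case: s => p q /= pq; rewrite /jump.
by repeat (case: ifP => /= ?); try congr (_, _); lia.
Qed.

(** In the first two rules [x] and [z] differ by at least 2, so their jumps commute. The last rule
    is the braid relation for neighbours; otherwise it follows from commutation and idempotence. *)
Lemma foldl_jump_kknuth s w w' : s.1 < s.2 -> w =K w' ->
  foldl jump s w = foldl jump s w'.
Proof.
move=> ls ww'; move: w w' ww' s ls.
apply: (kknuth_equiv_ind (R := fun w w' => forall s, s.1 < s.2 ->
  foldl jump s w = foldl jump s w')).
  split=> [//|w w' ww' s ls|w w' w'' ww' ww'' s ls]; first by rewrite ww'.
  by rewrite ww' ?ww''.
move=> u v a b ab s ls; rewrite !foldl_cat; congr (foldl _ _ v).
move: (foldl_jump_lt u ls) => {ls}; move: (foldl _ s u) => {u v}s ls.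
case: ab => [x y z xy yz|x y z xy yz|x|x y] /=.
- by rewrite (jumpC ls (leq_ltn_trans xy yz)).
- by rewrite (jumpC (jump_lt y ls) (leq_ltn_trans xy yz)).
- by rewrite jump_idem.
- wlog xy : x y / x < y.
    by move=> W; case: (ltngtP x y) => [/W //|/W-> //|->].
  have [<-|ltxy] := eqVneq x.+1 y; first exact: jump_braid.
  have {ltxy}xy : x.+1 < y by rewrite ltn_neqAle ltxy.
  by rewrite (jumpC ls xy) !jump_idem ?jump_lt // -(jumpC ls xy) jump_idem ?jump_lt.
Qed.

Lemma iota_rcons m n : iota m n.+1 = rcons (iota m n) (m + n).
Proof. by rewrite -addn1 iotaD cats1. Qed.

(** The letters decrease, so a particle moves at most once. The condition excludes only
    [q = p + 1 = m + n], where the second particle stays and can block the first. *)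
Lemma foldl_jump_rev_iota p q m n : p < q -> [|| p.+1 < q, q < m + n | m + n <= p] ->
  foldl jump (p, q) (rev (iota m n)) =
  (p + (m <= p < m + n), q + (m <= q < m + n)).
Proof.
elim: n p q => [|n IH] p q pq H.
  by rewrite /=; congr pair; lia.
rewrite iota_rcons rev_rcons /=.
case: eqP => qn; first by rewrite IH; [congr pair|..]; lia.
by case: ifP => ?; (rewrite IH; [congr pair|..]); lia.
Qed.

(** The run carries the first particle until it is blocked just before the second one, and from then
    on carries the second. *)
Lemma foldl_jump_iota q m n : m < q ->
  foldl jump (m, q) (iota m n) = (minn (m + n) q.-1, maxn (m + n) q).
Proof.
move=> mq; elim: n => [|n IH]; first by congr pair; lia.
rewrite iota_rcons foldl_rcons IH /jump.
by repeat (case: ifP => /= ?); congr pair; lia.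
Qed.

(* Starting from particles at [l - 1] and at [x - 1] (or [x], if [k < x]), both
   words bring the first particle to [l] and the second one to [x] with their
   initial segment; the extra letter [x] pushes the second one further. *)
Lemma no_extra_letter k l n x w w' :
  1 < l <= k.+1 -> l < x ->
  (forall s, s.1 < s.2 ->
    foldl jump s (rev (iota 1 k) ++ x :: iota l n) = foldl jump s w) ->
  subseq w w' -> ~ w' =K rev (iota 1 k) ++ iota l n.
Proof.
move=> /andP[l1 lk] lx eqw sub eqw'; pose q := if x <= k then x.-1 else x.
have l0 : l.-1 < q by rewrite /q; case: ifP; lia.
have start : foldl jump (l.-1, q) (rev (iota 1 k)) = (l, x).
  rewrite foldl_jump_rev_iota //; last by rewrite /q; case: ifP; lia.
  by rewrite /q; case: ifP => xk; congr pair; lia.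
have refl : pair_le (l.-1, q) (l.-1, q) by rewrite /pair_le !leqnn.
have := foldl_jump_subseq (s := (l.-1, q)) (t := (l.-1, q)) l0 l0 refl sub.
rewrite (foldl_jump_kknuth (s := (l.-1, q)) l0 eqw') -eqw // !foldl_cat start /=.
rewrite eqxx (foldl_jump_iota n lx) (foldl_jump_iota n (leqW lx)).
(* If [l + n <= x], the second coordinates violate the order; otherwise the first ones do. *)
by rewrite /pair_le /=; lia.
Qed.

(** * Necessity: a gap in the arm or leg allows a box at (1,1) *)

Lemma hook_tableau c A L : is_tableau (hook c A L) ->
  [/\ path ltn c A, path ltn c L & 0 < c].
Proof.
case/is_tableauP => /andP[pA _] abv _ pos; split=> //; last first.
  by apply: pos; rewrite mem_labels_hook mem_head.
case: L abv {pos} => //= x L /andP[/andP[-> _]].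
by rewrite path_map; congr (is_true _); apply: eq_path => y z /=; rewrite andbT.
Qed.

Lemma add_box_tableau c a A l L b : is_tableau (hook c (a :: A) (l :: L)) ->
  a < b -> l < b ->
  is_tableau ((c :: a :: A) :: [:: l; b] :: [seq [:: x] | x <- L]).
Proof.
move=> hT ab lb; case/is_tableauP: (hT) => /andP[sA /andP[_ sL]] abv nil0 pos.
have [/= /andP[ca _] /andP[cl pL] c0] := hook_tableau hT.
apply/is_tableauP; split.
- by apply/and3P; rewrite /= lb.
- by move: abv; rewrite /= cl ab; case: (L) => //= x ? /andP[_ /andP[/andP[-> _] ->]].
- by move: nil0; rewrite !inE.
- move=> x; have := pos x.
  rewrite mem_labels_hook /labels /= flatten_seq1 !(inE, mem_cat).
  by case: (eqVneq x b) => [-> _ _|_ /[apply]]; first exact: leq_ltn_trans ab.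
Qed.

(** The right-hand word is the row word of the hook with a box [b] added at (1,1). *)
Lemma URT_no_box c a A l L b : URT (hook c (a :: A) (l :: L)) ->
  a < b -> l < b ->
  ~ rev (l :: L) ++ [:: c, a & A] =K rev (l :: L) ++ [:: b, c, a & A].
Proof.
move=> [hT urt] ab lb eqT.
have := urt _ (add_box_tableau hT ab lb); apply: (@id (_ -> False)).
suff eqb : tableau_equiv ([:: c, a & A] :: [:: l; b] :: [seq [:: x] | x <- L])
    (hook c (a :: A) (l :: L)) by move/(_ eqb).
rewrite /tableau_equiv row_word_hook eqT /row_word !rev_cons !flatten_rcons.
by rewrite -map_rev flatten_seq1 cat_rcons -catA.
Qed.

Lemma consecutive_entries_iota s :
  consecutive_entries s -> s = iota (head 0 s) (size s).
Proof.
case: s => // a s cs; apply: (@eq_from_nth _ 0); rewrite ?size_iota // => i.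
elim: i => [|i IH] lti; first by rewrite nth_iota ?addn0.
by rewrite cs // IH ?(ltnW lti) // !nth_iota ?addnS // ltnW.
Qed.

Lemma sorted_consecutive s : sorted ltn s ->
  (forall i, i.+1 < size s -> ~~ ((nth 0 s i).+1 < nth 0 s i.+1)) ->
  consecutive_entries s.
Proof.
move=> /(sortedP 0) ss H i lti; have := ss i lti; have := H i lti.
by rewrite /=; lia.
Qed.

Lemma gap_notin s i : sorted ltn s -> i.+1 < size s ->
  (nth 0 s i).+1 < nth 0 s i.+1 -> (nth 0 s i).+1 \notin s.
Proof.
move=> ss lti gap; apply/negP => /(nthP 0)[j ltj ej].
have {}ej : nth 0 s j = (nth 0 s i).+1 :> nat := ej.
have lt_nth := sorted_ltn_nth ltn_trans 0 ss.
case: (ltngtP j i.+1) => [|ij|eji]; last by move: ej gap; rewrite eji; lia.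
  rewrite ltnS leq_eqVlt => /orP[/eqP eji|ji].
    by move: ej gap; rewrite eji; lia.
  have : nth 0 s j < nth 0 s i := lt_nth j i ltj (ltnW lti) ji.
    by rewrite ej; lia.
have : nth 0 s i.+1 < nth 0 s j := lt_nth i.+1 j lti ltj ij.
by rewrite ej; lia.
Qed.

Lemma path_head_le c a s x : path ltn c (a :: s) -> x \in a :: s -> a <= x.
Proof.
move=> /= /andP[_ /(order_path_min ltn_trans)/allP as_x].
by rewrite inE => /predU1P[->//|/as_x/ltnW].
Qed.

(** Initiality enters here: the label missing from [A] must occur somewhere, and it is not the
    corner. *)
Lemma mem_gap n A B i :
  (forall x, x \in 1 :: A ++ B = (1 <= x <= n)) ->
  path ltn 1 A -> i.+1 < size A -> (nth 0 A i).+1 < nth 0 A i.+1 ->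
  (nth 0 A i).+1 \in B.
Proof.
move=> lab pA lti gap.
have := lab (nth 0 A i.+1); rewrite inE mem_cat mem_nth // orbT => /esym/andP[_ ltn].
have := lab (nth 0 A i).+1; rewrite (leq_trans _ ltn) ?(ltnW gap) //.
rewrite inE mem_cat (negPf (gap_notin (path_sorted pA) lti gap)) /=.
have /allP/(_ _ (mem_nth 0 (ltnW lti)))/= := order_path_min ltn_trans pA.
by rewrite eqSS; case: eqP => // ->.
Qed.

Lemma URT_consecutive n A L :
  (forall x, x \in 1 :: A ++ L = (1 <= x <= n)) -> URT (hook 1 A L) ->
  consecutive_entries A /\ consecutive_entries L.
Proof.
move=> lab urt; have [pA pL _] := hook_tableau urt.1.
have labC x : x \in 1 :: L ++ A = (1 <= x <= n).
  by rewrite -lab !inE !mem_cat (orbC (x \in L)).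
have [sA sL] := (path_sorted pA, path_sorted pL).
split; apply: sorted_consecutive => // i lti; apply/negP => gap.
  have yL := mem_gap lab pA lti gap.
  have := arm_gap pA pL lti gap yL.
  case: A L => [|a A] [|l L] // in sA sL lab urt pA pL labC lti gap yL *.
  apply: URT_no_box => //; apply: leq_ltn_trans gap.
    by apply: leqW; apply: path_head_le pA _; rewrite mem_nth // ltnW.
  exact: path_head_le pL _.
have yA := mem_gap labC pL lti gap.
have := kknuth_rev (arm_gap pL pA lti gap yA).
rewrite !rev_cat !rev_cons !revK !cat_rcons.
case: A L => [|a A] [|l L] // in sA sL lab urt pA pL labC lti gap yA *.
have lb : l < nth 0 (l :: L) i.+1.
  apply: leq_ltn_trans gap.
  by apply: leqW; apply: path_head_le pL _; rewrite mem_nth // ltnW.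
have /andP[cl _] := pL.
(* Reversal has left the new letter [b] to the right of the corner; the move from [l 1 b] to [l b 1]
   puts it where the box (1,1) is read. *)
rewrite {2}rev_cons cat_rcons (kyxz _ cl lb) -(cat_rcons l) -rev_cons.
apply: URT_no_box => //; apply: leq_ltn_trans gap.
exact: path_head_le pA _.
Qed.

(** * Sufficiency: consecutive arm and leg exclude a box at (1,1) *)

Lemma rows_of_size1 r R :
  size r <= 1 -> sorted above (r :: R) -> [::] \notin R ->
  R = [seq [:: x] | x <- first_col R].
Proof.
elim: R r => //= s R IH r r1 /andP[/aboveP[sr _] aR].
rewrite inE negb_or => /andP[s0 R0].
have s1 := leq_trans sr r1; rewrite -(IH s) //.
by case: s s0 s1 {sr aR} => [|x [|]].
Qed.

Lemma subseq_first_col R :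
  [::] \notin R -> subseq (first_col R) (flatten (map rev R)).
Proof.
elim: R => //= r R IH; rewrite inE negb_or => /andP[r0 /IH sub].
rewrite -cat1s cat_subseq // sub1seq mem_rev.
by case: r r0 => // a r _; rewrite mem_head.
Qed.

(** Otherwise the label [s.+2] would be missing. This supplies the bound [l <= k.+1] of
    [no_extra_letter]. *)
Lemma interval_cover n A B b s t :
  (forall x, x \in 1 :: A ++ B = (1 <= x <= n)) ->
  A = iota 2 s -> B = iota b t -> 0 < t -> b <= s.+2.
Proof.
move=> lab eA eB t0; rewrite leqNgt; apply/negP => ltb.
have := lab b; rewrite eA eB !(inE, mem_cat, mem_iota).
by have := lab s.+2; rewrite eA eB !(inE, mem_cat, mem_iota); lia.
Qed.

Lemma consecutive_no_box n A L R x l s :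
  (forall x, x \in 1 :: A ++ L = (1 <= x <= n)) ->
  consecutive_entries A -> consecutive_entries L ->
  is_tableau (hook 1 A L) -> is_tableau ((1 :: A) :: [:: l, x & s] :: R) ->
  l :: first_col R = L ->
  ~ tableau_equiv ((1 :: A) :: [:: l, x & s] :: R) (hook 1 A L).
Proof.
move=> lab cA cL hT hT' defL; rewrite /tableau_equiv row_word_hook => eqw.
have [pA pL _] := hook_tableau hT.
have /is_tableauP[/and3P[_ /= /andP[lx _] _] /= /andP[/andP[_ abA] _]] := hT'.
rewrite !inE !negb_or /= => R0 _.
have labC y : y \in 1 :: L ++ A = (1 <= y <= n).
  by rewrite -lab !inE !mem_cat (orbC (y \in L)).
case: A => // a A in lab labC cA hT hT' eqw pA abA *.
case/andP: abA => ax _.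
have sub : subseq (rev [:: 1, a & A] ++ x :: L)
    (rev (row_word ([:: 1, a & A] :: [:: l, x & s] :: R))).
  rewrite rev_row_word -defL /= !cat_subseq //.
  rewrite -[[:: x, l & _]]/([:: x; l] ++ _) cat_subseq ?subseq_first_col //.
  by rewrite !rev_cons -!cats1 -catA suffix_subseq.
have lL : l \in L by rewrite -defL mem_head.
have l1 : 1 < l by have /allP/(_ _ lL) := order_path_min ltn_trans pL.
have a1 : 1 < a by case/andP: pA.
have eA : a :: A = iota a (size (a :: A)) := consecutive_entries_iota cA.
have eL : L = iota l (size L).
  by rewrite [LHS]consecutive_entries_iota //= -{1}defL.
(* The label 2 must begin the arm or the leg. The first case is treated with reversed words, the
   second with the row words themselves. *)
have : (a == 2) || (l == 2).
  have := lab l; rewrite inE mem_cat lL !orbT => /esym/andP[_ ln].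
  have := lab 2; rewrite (leq_trans l1 ln) inE mem_cat.
  case/or3P => // [/(path_head_le pA)|]; first by lia.
  by rewrite -{1}defL => /(path_head_le (c := 1)); rewrite defL => /(_ pL); lia.
have iota1 t : iota 1 t.+1 = 1 :: iota 2 t by [].
case/orP => /eqP e2.
- have {}eA : a :: A = iota 2 (size (a :: A)) by rewrite -e2.
  have lk : l <= (size (a :: A)).+2.
    by apply: interval_cover lab eA eL _; case: (L) lL.
  have base : rev [:: 1, a & A] ++ L =
              rev (iota 1 (size (a :: A)).+1) ++ iota l (size L).
    by rewrite -eL iota1 -eA.
  apply: (no_extra_letter (k := (size (a :: A)).+1) (n := size L) _ lx _ sub).
  + by rewrite l1; exact: lk.
  + by move=> st _; rewrite iota1 -eA -eL.
  + by have := kknuth_rev eqw; rewrite rev_cat revK base.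
- have {}eL : L = iota 2 (size L) by rewrite -e2.
  have ak : a <= (size L).+2 by apply: interval_cover labC eL eA _.
  have base t : rev L ++ 1 :: t = rev (iota 1 (size L).+1) ++ t.
    by rewrite iota1 -eL rev_cons cat_rcons.
  rewrite -subseq_rev revK in sub.
  apply: (no_extra_letter (k := (size L).+1) (n := size (a :: A)) _ ax _ sub).
  + by rewrite a1; exact: ak.
  + move=> st lt_st; rewrite -base -eA rev_cat revK rev_cons cat_rcons.
    (* In the row word [x] comes before [1] rather than after it; their jumps commute since [x]
       exceeds 2. *)
    have lt2x : 2 < x by move: lx; rewrite e2.
    by rewrite !foldl_cat /= (jumpC (foldl_jump_lt _ lt_st) lt2x).
  + by rewrite eqw base -eA.
Qed.

Theorem theorem6p4 (T : filling) (hT : is_tableau T) (hinit : initial T)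
    (hhook : hook_shaped T) :
  URT T <-> consecutive_entries (arm T) /\ consecutive_entries (leg T).
Proof.
have [c defT] := hook_shapedP hhook; move: (arm T) (leg T) defT => A L defT.
subst T; have [pA pL c0] := hook_tableau hT; case: hinit => n.
move=> lab0.
(* The corner is smaller than all other labels, and 1 is a label. *)
have c1 : c = 1.
  have := lab0 c; have := lab0 1; rewrite !mem_labels_hook mem_head.
  rewrite inE mem_cat => + /esym/andP[_ /(leq_trans c0) n0]; rewrite n0.
  have min s : path ltn c s -> 1 \in s -> c = 1.
    by move/(order_path_min ltn_trans)/allP => lt_c /lt_c /=; lia.
  by case/or3P => [/eqP//| |]; exact: min.
subst c.
have lab x : x \in 1 :: A ++ L = (1 <= x <= n) by rewrite -lab0 mem_labels_hook.
split=> [|[cA cL]]; first exact: URT_consecutive lab.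
split=> // T' hT' eqT.
have [er ec] := equiv_first_row_col hT hT' eqT.
case: T' => [|r R] //= in hT' eqT er ec *.
move: er ec; rewrite /first_row /first_col /= => er [_ ec]; subst r.
have {}ec : first_col R = L by rewrite /first_col ec -[RHS]map_id -map_comp.
suff -> : R = [seq [:: x] | x <- L] by [].
have /is_tableauP[_ aT] := hT'; rewrite inE negb_or => /andP[_ nR] _.
(* A second row of length one forces a hook, which its first row and column determine; a longer one
   contains the box (1,1). *)
case: R => [|[|l [|x s]] R] in hT' eqT ec aT nR *.
- by rewrite -ec.
- by rewrite inE eqxx in nR.
- rewrite -ec; move: nR; rewrite inE negb_or => /andP[_ nR] /=.
  by rewrite -(@rows_of_size1 [:: l] R) //; case/andP: aT.
- by case: (consecutive_no_box lab cA cL hT hT' ec).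
Qed.
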